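(* Assume the Continuum Hypothesis. Then for every $n \in \mathbb{N}\setminus\{0\}$ and every $m \in \mathbb{N}$ there exists a maximal cofinitary group $G \le \mathrm{Sym}(\mathbb{N})$ whose natural action on $\mathbb{N}$ has exactly $n$ infinite orbits and exactly $m$ finite orbits.
   Context: $\mathrm{Sym}(\mathbb{N})$ is the group of bijections $\mathbb{N}\to\mathbb{N}$ under composition. A permutation is cofinitary if it is the identity or has only finitely many fixed points. A subgroup of $\mathrm{Sym}(\mathbb{N})$ is cofinitary if all its elements are cofinitary, and maximal cofinitary if it is cofinitary and not properly contained in another cofinitary subgroup. The natural action is $g\cdot k = g(k)$. *)

(* Defs.v *)
From Stdlib Require Import Arith.

Definition CH : Prop :=
  forall A : (nat -> bool) -> Prop,
    (exists f : {x | A x} -> nat, forall a b, f a = f b -> a = b) \/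
    (exists f : {x | A x} -> (nat -> bool),
        (forall a b, f a = f b -> a = b) /\ (forall y, exists a, f a = y)).

Definition bijective_nat (f : nat -> nat) : Prop :=
  (forall x y, f x = f y -> x = y) /\ (forall y, exists x, f x = y).

Definition is_subgroup_Sym (G : (nat -> nat) -> Prop) : Prop :=
  (forall f, G f -> bijective_nat f) /\
  G (fun k => k) /\
  (forall f g, G f -> G g -> G (fun k => f (g k))) /\
  (forall f, G f -> exists h, G h /\ (forall k, h (f k) = k) /\ (forall k, f (h k) = k)).

Definition cofinitary (f : nat -> nat) : Prop :=
  (forall k, f k = k) \/ (exists N, forall k, f k = k -> k < N).

Definition cofinitary_group (G : (nat -> nat) -> Prop) : Prop :=
  is_subgroup_Sym G /\ (forall f, G f -> cofinitary f).

Definition maximal_cofinitary_group (G : (nat -> nat) -> Prop) : Prop :=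
  cofinitary_group G /\
  (forall H, cofinitary_group H -> (forall f, G f -> H f) -> (forall f, H f -> G f)).

Definition same_orbit (G : (nat -> nat) -> Prop) (x y : nat) : Prop :=
  exists g, G g /\ g x = y.

Definition finite_orbit (G : (nat -> nat) -> Prop) (x : nat) : Prop :=
  exists N, forall y, same_orbit G x y -> y < N.

Definition infinite_orbit (G : (nat -> nat) -> Prop) (x : nat) : Prop :=
  ~ finite_orbit G x.

(* The number of G-orbits whose points satisfy P (an orbit-invariant property)
   is exactly c: there are c representatives in pairwise distinct orbits
   satisfying P, and every point satisfying P is in the orbit of one of them. *)
Definition num_orbits_with (G : (nat -> nat) -> Prop) (P : nat -> Prop) (c : nat) : Prop :=
  exists r : nat -> nat,
    (forall i, i < c -> P (r i)) /\
    (forall i j, i < c -> j < c -> same_orbit G (r i) (r j) -> i = j) /\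
    (forall x, P x -> exists i, i < c /\ same_orbit G (r i) x).

(* Main.v *)
(* Colour the points so that the points below m have private colours and the
   other n colours have infinitely many points; the groups considered preserve
   the colours, and the first one is transitive on every colour, so that the
   orbits never change. Under CH all functions f are treated in a transfinite
   recursion through countable groups: if f is not yet in the group U, and no
   element h f with h in U rules f out already by having infinitely many fixed
   points, a permutation g that is generic over U is adjoined such that
   g f^-1 g f has infinitely many fixed points without being the identity. Then
   f lies in no cofinitary group above <U, g>. The requirement on g is a family
   of pairs of edges f x -> f y, y -> x of its graph, where y is chosen generic
   for given x: no cyclically reduced word in g traverses such a new edge in a
   closed walk, so <U, g> remains cofinitary. *)

From mathcomp Require ssrbool eqtype boolp wochoice.
From Stdlib Require Import ssreflect.
From Stdlib Require Import Arith Lia List Wellfounded Cantor.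
From Stdlib Require Import ClassicalEpsilon PropExtensionality FunctionalExtensionality.
Require Import Defs.

(** * Well-orders with countable initial segments under CH *)

Section WellOrder.
Import ssrbool eqtype boolp wochoice.

(** Antisymmetry comes from uniqueness of minima: if [x] and [y] lie below each other, both are the
    minimum of the pair. *)
Lemma minima_order (T : Type) :
  exists R : T -> T -> Prop,
    (forall x y, R x y -> R y x -> x = y) /\
    (forall P : T -> Prop, (exists x, P x) ->
       exists z, P z /\ forall y, P y -> R z y).
Proof.
have [R Rwo] := well_ordering_principle {classic T}.
have Rmin (P : T -> Prop) : (exists x, P x) ->
    exists z, P z /\ forall y, P y -> R z y.
  move=> [x Px]; have [|z [[/asboolP Pz zmin] _]] := Rwo (fun x => `[<P x>]).
    by exists x; apply/asboolP.
  by exists z; split=> // y Py; apply: zmin; apply/asboolP.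
exists R; split=> // x y Rxy Ryx.
have Rr (z : T) : R z z.
  have [|t [-> h]] := Rmin (fun t => t = z); first by exists z.
  exact: h.
have ne : wochoice.nonempty (fun z : {classic T} => `[<z = x \/ z = y>]).
  by exists x; apply/asboolP; left.
have [z [_ zU]] := Rwo _ ne.
have zx : z = x.
  apply: zU; split; first by apply/asboolP; left.
  by move=> t /asboolP [->|->].
have zy : z = y.
  apply: zU; split; first by apply/asboolP; right.
  by move=> t /asboolP [->|->].
by rewrite -zx.
Qed.

End WellOrder.

Lemma well_ordering (T : Type) :
  exists R : T -> T -> Prop,
    well_founded R /\ (forall x y, R x y \/ x = y \/ R y x) /\
    (forall x y z, R x y -> R y z -> R x z).
Proof.
have [S [Santi Smin]] := minima_order T.
pose R x y := ~ S y x.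
have Rwf : well_founded R.
  move=> x; apply: NNPP => nAx.
  have [|z [nAz zmin]] := Smin (fun x => ~ Acc R x); first by exists x.
  by apply: nAz; constructor => y Ryz; apply: NNPP => /zmin.
have Rtot x y : R x y \/ x = y \/ R y x.
  case: (classic (S y x)) => [Syx|]; last by left.
  case: (classic (S x y)) => [Sxy|]; last by right; right.
  by right; left; apply: Santi.
have Rirr x y : R x y -> R y x -> False.
  move: y; elim/(well_founded_ind Rwf): x => x IH y Rxy Ryx.
  exact: (IH y Ryx x).
exists R; split=> //; split=> // x y z Rxy Ryz.
case: (Rtot x z) => [//|[xz|Rzx]]; first by subst z; case: (Rirr x y).
(* What remains is a cycle of [x], [y], [z]; the least of the three cannot lie strictly above its
   predecessor in the cycle. *)
case: (Smin (fun t => t = x \/ t = y \/ t = z)); first by exists x; left.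
by move=> t [[->|[->|->]] tmin]; [case: Rzx|case: Rxy|case: Ryz]; apply: tmin; tauto.
Qed.

Definition segment_countable {X : Type} (R : X -> X -> Prop) (x : X) :=
  exists f : X -> nat, forall y z, R y x -> R z x -> f y = f z -> y = z.

Lemma extend_sig {X : Type} (A : X -> Prop) (f : {x | A x} -> nat) :
  exists g : X -> nat, forall x (Ax : A x), g x = f (exist _ x Ax).
Proof.
exists (fun x => match excluded_middle_informative (A x) with
                 | left Ax => f (exist _ x Ax) | right _ => 0 end) => x Ax.
case: excluded_middle_informative => [Ax'|//].
by rewrite (proof_irrelevance _ Ax Ax').
Qed.

(** CH is applied to the set [A] of points with a countable initial segment. If [A] has the size of
    the continuum, [A] itself with the restricted order serves. If [A] is countable, induction puts
    every point into [A], since its segment is contained in [A], and the whole order serves. *)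
Lemma CH_well_order :
  CH -> exists (X : Type) (R : X -> X -> Prop) (e : X -> nat -> bool),
    well_founded R /\ (forall x y, R x y \/ x = y \/ R y x) /\
    (forall x, segment_countable R x) /\ (forall b, exists x, e x = b).
Proof.
move=> ch; have [R [Rwf [Rtot Rtr]]] := well_ordering (nat -> bool).
pose A := segment_countable R.
have subR : well_founded (fun u v : {x | A x} => R (proj1_sig u) (proj1_sig v)).
  exact: (wf_inverse_image _ _ R (@proj1_sig _ A) Rwf).
have subtot (u v : {x | A x}) :
    R (proj1_sig u) (proj1_sig v) \/ u = v \/ R (proj1_sig v) (proj1_sig u).
  case: (Rtot (proj1_sig u) (proj1_sig v)) => [|[|]]; [tauto| |tauto].
  move: u v => [x Ax] [y Ay] /= xy; subst y.
  by rewrite (proof_irrelevance _ Ax Ay); tauto.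
have subseg (u : {x | A x}) :
    segment_countable (fun u v : {x | A x} => R (proj1_sig u) (proj1_sig v)) u.
  case: (proj2_sig u) => f finj; exists (fun v => f (proj1_sig v)).
  move=> [y Ay] [z Az] /= Ryu Rzu /(finj _ _ Ryu Rzu) yz; subst z.
  by rewrite (proof_irrelevance _ Ay Az).
case: (ch A) => [[f finj]|[f [_ fsurj]]]; last first.
  by exists {x | A x}, (fun u v => R (proj1_sig u) (proj1_sig v)), f.
have [g gE] := extend_sig A f.
have allA x : A x.
  elim/(well_founded_ind Rwf): x => x IH; exists g => y z Ryx Rzx.
  rewrite (gE y (IH _ Ryx)) (gE z (IH _ Rzx)) => /finj yz.
  exact: (f_equal (@proj1_sig _ A) yz).
by exists (nat -> bool), R, id; do !split=> //; move=> b; exists b.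
Qed.
(** * Finite approximations of a generic permutation *)

Definition eventually (P : nat -> Prop) := exists N, forall k, N <= k -> P k.

Definition injective_nat (h : nat -> nat) := forall x y, h x = h y -> x = y.

Definition is_identity (h : nat -> nat) := forall k, h k = k.

Lemma eventually_True (P : nat -> Prop) : (forall k, P k) -> eventually P.
Proof. by move=> h; exists 0. Qed.

Lemma eventually_mono (P Q : nat -> Prop) :
  (forall k, P k -> Q k) -> eventually P -> eventually Q.
Proof. by move=> h [N hN]; exists N => k /hN; apply: h. Qed.

Lemma eventually_and (P Q : nat -> Prop) :
  eventually P -> eventually Q -> eventually (fun k => P k /\ Q k).
Proof.
by move=> [N hN] [M hM]; exists (N + M) => k le; split; [apply: hN|apply: hM]; lia.
Qed.

Lemma eventually_lt (P : nat -> nat -> Prop) s :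
  (forall i, eventually (P i)) -> eventually (fun k => forall i, i < s -> P i k).
Proof.
move=> h; elim: s => [|s IH]; first by exists 0; lia.
apply: eventually_mono (eventually_and _ _ IH (h s)) => k [h1 h2] i lt.
case: (Nat.eq_dec i s) => [->//|ne]; apply: h1; lia.
Qed.

Lemma eventually_In (P : nat -> nat -> Prop) l :
  (forall d, eventually (P d)) -> eventually (fun k => forall d, In d l -> P d k).
Proof.
move=> h; elim: l => [|a l IH]; first by exists 0.
by apply: eventually_mono (eventually_and _ _ IH (h a)) => k [h1 h2] d [<-//|/h1].
Qed.

Lemma eventually_ge M : eventually (fun k => M <= k).
Proof. by exists M. Qed.

Lemma eventually_inj_neq h d : injective_nat h -> eventually (fun k => h k <> d).
Proof.
move=> hinj; case: (classic (exists v, h v = d)) => [[v hv]|nv].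
  by exists (S v) => k le e; have kv := hinj k v ltac:(congruence); lia.
by exists 0 => k _ e; apply: nv; exists k.
Qed.

Lemma eventually_neq d : eventually (fun k => k <> d).
Proof. by exists (S d); lia. Qed.

Lemma eventually_neq_sym d : eventually (fun k => d <> k).
Proof. by exists (S d); lia. Qed.

Lemma eventually_inj_ge h N : injective_nat h -> eventually (fun k => N <= h k).
Proof.
move=> hinj.
have := eventually_lt (fun d k => h k <> d) N (fun d => eventually_inj_neq h d hinj).
apply: eventually_mono => k hk.
by case: (le_lt_dec N (h k)) => // lt; case: (hk _ lt).
Qed.

Lemma eventually_comp_inj (P : nat -> Prop) h :
  injective_nat h -> eventually P -> eventually (fun k => P (h k)).
Proof.
move=> hinj [N hN]; apply: eventually_mono (eventually_inj_ge h N hinj).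
by move=> k; apply: hN.
Qed.

Definition unbounded (P : nat -> Prop) := forall N, exists k, N <= k /\ P k.

Lemma unbounded_eventually (P Q : nat -> Prop) :
  unbounded P -> eventually Q -> exists k, P k /\ Q k.
Proof. by move=> hP [N hN]; case: (hP N) => k [le Pk]; exists k; split=> //; apply: hN. Qed.

Lemma not_unbounded (P : nat -> Prop) : ~ unbounded P -> eventually (fun k => ~ P k).
Proof.
move=> nP; apply: NNPP => nE; apply: nP => N; apply: NNPP => nk.
by apply: nE; exists N => k le Pk; apply: nk; exists k.
Qed.

Lemma unbounded_fiber (col : nat -> nat) K :
  (forall x, col x < K) -> exists i, unbounded (fun x => col x = i).
Proof.
move=> hcol; apply: NNPP => nex.
have [|N hN] := eventually_lt (fun i x => col x <> i) K.
  move=> i; apply: not_unbounded => u; apply: nex; by exists i.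
exact: (hN N (le_n N) (col N)).
Qed.

(** * Finite partial permutations and their closed walks *)

Definition edge (p : list (nat * nat)) (x y : nat) := In (x, y) p.

Definition points (p : list (nat * nat)) := map fst p ++ map snd p.

Lemma points_edge p x y : edge p x y -> In x (points p) /\ In y (points p).
Proof.
move=> e; split; apply/in_app_iff; [left|right]; exact: (in_map _ _ _ e).
Qed.

Lemma pointsP p x :
  In x (points p) -> exists y, edge p x y \/ edge p y x.
Proof.
move/in_app_iff => [] /in_map_iff [[a b] /= [<- h]].
- by exists b; left.
- by exists a; right.
Qed.

Lemma points_cons u v p x :
  In x (points ((u, v) :: p)) -> x = u \/ x = v \/ In x (points p).
Proof.
move/pointsP => [y [[[-> _]|e]|[[_ ->]|e]]]; try tauto; have := points_edge _ _ _ e; tauto.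
Qed.

Definition step (R : nat -> nat -> Prop) (e : bool) (x y : nat) :=
  if e then R x y else R y x.

(* The closed walk of period [k] traced by a cyclically reduced word
   [R^(e j) o en (i j)], one letter for each [j], read periodically. *)
Record closed_walk (en : nat -> nat -> nat) (s : nat) (R : nat -> nat -> Prop)
    (k : nat) (e : nat -> bool) (i x : nat -> nat) : Prop := ClosedWalk {
  walk_pos : 0 < k;
  walk_e : forall j, e (j + k) = e j;
  walk_i : forall j, i (j + k) = i j;
  walk_x : forall j, x (j + k) = x j;
  walk_letters : forall j, i j < s;
  walk_reduced : forall j, e j <> e (S j) -> ~ is_identity (en (i (S j)));
  walk_step : forall j, step R (e j) (en (i j) (x j)) (x (S j)) }.

(** The promise made at stage [s]: edges added later lie on no closed walk whose letters have index
    below [s]. In this form it is transitive along the construction. *)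
Definition good_ext en s p q :=
  incl p q /\ forall k e i x, closed_walk en s (edge q) k e i x ->
    closed_walk en s (edge p) k e i x.

Lemma good_ext_refl en s p : good_ext en s p p.
Proof. by split; [apply: incl_refl|]. Qed.

Lemma good_ext_trans en s p q r :
  good_ext en s p q -> good_ext en s q r -> good_ext en s p r.
Proof.
move=> [i1 h1] [i2 h2]; split; first exact: incl_tran i1 i2.
by move=> k e i x /h2 /h1.
Qed.

Lemma good_ext_le en s s' p q : s <= s' -> good_ext en s' p q -> good_ext en s p q.
Proof.
move=> le [inc h]; split=> // k e i x [h1 h2 h3 h4 h5 h6 h7].
have [|? ? ? ? ? ? h7'] := h k e i x; last by split.
by split=> // j; have := h5 j; lia.
Qed.

(** A walk can pass through such a point only by a trivial letter, and then only by turning back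
    along the same kind of edge, which reducedness forbids. *)
Definition isolated en s q t :=
  ~ ((exists a, edge q t a) /\ (exists b, edge q b t)) /\
  forall i, i < s -> forall d, In d (points q) ->
    en i t = d \/ en i d = t -> is_identity (en i).

(* A cyclically reduced walk cannot turn around at an isolated point. *)
Lemma isolated_good_ext en s p q :
  incl p q ->
  (forall x y, edge q x y -> edge p x y \/ isolated en s q x \/ isolated en s q y) ->
  good_ext en s p q.
Proof.
move=> inc new; split=> // k e i x [h1 h2 h3 h4 h5 h6 h7].
(* The index [S j] guarantees a preceding step; periodicity recovers step [j] from [j + k - 1]. *)
suff main j : step (edge p) (e (S j)) (en (i (S j)) (x (S j))) (x (S (S j))).
  split=> // j; have := main (j + k - 1).
  have -> : S (j + k - 1) = j + k by lia.
  have -> : S (j + k) = S j + k by lia.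
  by rewrite h2 h3 !h4.
have pt b y z : step (edge q) b y z -> In y (points q) /\ In z (points q).
  by case: b => /points_edge; tauto.
(* If the start of the step were isolated, the letter before it would be trivial, so the sign is
   unchanged and the point has both an incoming and an outgoing edge. The end of the step is treated
   alike with the step after it. *)
have src : ~ isolated en s q (en (i (S j)) (x (S j))).
  move=> [two iso]; have s1 := h7 j; have s2 := h7 (S j).
  have id1 : is_identity (en (i (S j))).
    by apply: (iso _ (h5 _) (x (S j))); [have := pt _ _ _ s1; tauto|right].
  have ee : e j = e (S j).
    by case: (Bool.bool_dec (e j) (e (S j))) => // /h6.
  apply: two; rewrite id1 in s2 *; move: s1 s2; rewrite ee.
  by case: (e (S j)) => /= s1 s2; split; eexists; eassumption.
have tgt : ~ isolated en s q (x (S (S j))).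
  move=> [two iso]; have s1 := h7 (S j); have s2 := h7 (S (S j)).
  have id1 : is_identity (en (i (S (S j)))).
    by apply: (iso _ (h5 _) (en (i (S (S j))) (x (S (S j))))); [have := pt _ _ _ s2; tauto|left].
  have ee : e (S j) = e (S (S j)).
    by case: (Bool.bool_dec (e (S j)) (e (S (S j)))) => // /h6.
  apply: two; rewrite id1 in s2; move: s1 s2; rewrite ee.
  by case: (e (S (S j))) => /= s1 s2; split; eexists; eassumption.
have := h7 (S j); rewrite /step; case: (e (S j)) => /new; tauto.
Qed.

Definition fresh en s l y :=
  ~ In y l /\ forall i, i < s ->
    (forall d, In d l -> en i y <> d /\ en i d <> y) /\
    (en i y = y -> is_identity (en i)).

Lemma eventually_fresh en s l :
  (forall i, injective_nat (en i)) ->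
  (forall i, is_identity (en i) \/ eventually (fun y => en i y <> y)) ->
  eventually (fresh en s l).
Proof.
move=> einj ecof; apply: eventually_and.
  have := eventually_In (fun d y => y <> d) l eventually_neq.
  by apply: eventually_mono => k h /h.
apply: eventually_lt => i; apply: eventually_and.
  apply: eventually_In => d; apply: eventually_and; first exact: eventually_inj_neq.
  exact: eventually_neq_sym.
case: (ecof i) => [id|]; first exact: eventually_True.
exact: eventually_mono.
Qed.

(** The points below [m], alone in their colours, are fixed from the start, so that every later edge
    concerns colours with infinitely many points. *)
Record valid (c : nat -> nat) m (p : list (nat * nat)) : Prop := Valid {
  valid_col : forall x y, edge p x y -> c x = c y;
  valid_fun : forall x y z, edge p x y -> edge p x z -> y = z;
  valid_inj : forall x y z, edge p x z -> edge p y z -> x = y;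
  valid_fix : forall x, x < m -> edge p x x }.

Lemma valid_cons c m p u v :
  valid c m p -> c u = c v -> (forall y, ~ edge p u y) -> (forall x, ~ edge p x v) ->
  valid c m ((u, v) :: p).
Proof.
move=> [h1 h2 h3 h4] cuv nu nv; split.
- by move=> x y [[<- <-]//|]; apply: h1.
- move=> x y z [[<- <-]|e1] [[]|e2]; try congruence.
  + by case: (nu _ e2).
  + by move=> ux; subst u; case: (nu _ e1).
  + exact: h2 e1 e2.
- move=> x y z [[<- <-]|e1] [[]|e2]; try congruence.
  + by case: (nv _ e2).
  + by move=> _ vz; subst v; case: (nv _ e1).
  + exact: h3 e1 e2.
- by move=> x lt; right; apply: h4.
Qed.
Lemma fresh_isolated_target en s p u v :
  fresh en s (u :: points p) v -> isolated en s ((u, v) :: p) v.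
Proof.
move=> [vl fr]; split.
  move=> [[a [[uv _]|e]] _]; apply: vl; first by left.
  by right; case: (points_edge _ _ _ e).
move=> i lt d /points_cons dq; have [h1 h2] := fr i lt.
case: dq => [->|[->|dp]]; [|tauto|]; have := h1 _ ltac:(simpl; eauto); tauto.
Qed.

Lemma fresh_isolated_source en s p u v :
  fresh en s (u :: points p) v -> isolated en s ((v, u) :: p) v.
Proof.
move=> [vl fr]; split.
  move=> [_ [a [[_ uv]|e]]]; apply: vl; first by left.
  by right; case: (points_edge _ _ _ e).
move=> i lt d /points_cons dq; have [h1 h2] := fr i lt.
case: dq => [->|[->|dp]]; [tauto| |]; have := h1 _ ltac:(simpl; eauto); tauto.
Qed.

Definition eventually_moving (h : nat -> nat) := eventually (fun y => h y <> y).

Section Extensions.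

Variables (en : nat -> nat -> nat) (c : nat -> nat) (m : nat).
Hypothesis en_inj : forall i, injective_nat (en i).
Hypothesis en_cof : forall i, is_identity (en i) \/ eventually_moving (en i).
Hypothesis c_unbounded : forall x, m <= x -> unbounded (fun y => c y = c x).

(** The edge leaving [u] may end at any fresh point of the colour of [u], and a fresh endpoint is
    isolated. *)
Lemma extend_domain s p u : valid c m p ->
  exists q, valid c m q /\ good_ext en s p q /\ exists v, edge q u v.
Proof.
move=> vp; case: (classic (exists v, edge p u v)) => [[v e]|nu].
  by exists p; split=> //; split; [apply: good_ext_refl|exists v].
have mu : m <= u.
  by apply/Nat.nlt_ge => /(valid_fix _ _ _ vp) e; apply: nu; exists u.
have [v [cv fv]] := unbounded_eventually _ _ (c_unbounded u mu)
  (eventually_fresh en s (u :: points p) en_inj en_cof).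
exists ((u, v) :: p); split; [|split; last by exists v; left].
  apply: valid_cons => //; first by move=> y e; apply: nu; exists y.
  by move=> x /points_edge [_ e]; apply: (proj1 fv); right.
apply: isolated_good_ext; first by move=> ? ?; right.
move=> x y [[<- <-]|]; last by left.
by right; right; apply: fresh_isolated_target.
Qed.

Lemma extend_range s p u : valid c m p ->
  exists q, valid c m q /\ good_ext en s p q /\ exists v, edge q v u.
Proof.
move=> vp; case: (classic (exists v, edge p v u)) => [[v e]|nu].
  by exists p; split=> //; split; [apply: good_ext_refl|exists v].
have mu : m <= u.
  by apply/Nat.nlt_ge => /(valid_fix _ _ _ vp) e; apply: nu; exists u.
have [v [cv fv]] := unbounded_eventually _ _ (c_unbounded u mu)
  (eventually_fresh en s (u :: points p) en_inj en_cof).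
exists ((v, u) :: p); split; [|split; last by exists v; left].
  apply: valid_cons => //; last by move=> y e; apply: nu; exists y.
  by move=> x /points_edge [e _]; apply: (proj1 fv); right.
apply: isolated_good_ext; first by move=> ? ?; right.
move=> x y [[<- <-]|]; last by left.
by right; left; apply: fresh_isolated_source.
Qed.

Variable f : nat -> nat.
Hypothesis f_inj : injective_nat f.
Hypothesis f_moving : eventually_moving f.
Hypothesis en_f_moving : forall i, eventually (fun y => en i (f y) <> y).
Hypothesis en_ne_f : forall i, eventually (fun y => en i y <> f y).

(* Both new edges have an endpoint, [f y] resp. [y], that no letter of the
   word links to another endpoint: a link between [y] and [f y] would be a
   fixed point of [en i o f] or of its inverse. *)
Lemma extend_hit s p u v :
  valid c m p -> (forall y, ~ edge p u y) -> (forall x, ~ edge p x v) ->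
  unbounded (fun y => c y = c v /\ c (f y) = c u) ->
  exists q, valid c m q /\ good_ext en s p q /\
    exists y, edge q u (f y) /\ edge q y v.
Proof.
move=> vp nu nv unb.
pose l := u :: v :: points p.
have [y [[cy cfy] [fy [ffy [ne [h1 h2]]]]]] : exists y,
    (c y = c v /\ c (f y) = c u) /\ fresh en s l y /\ fresh en s l (f y) /\
    f y <> y /\ (forall i, i < s -> en i (f y) <> y) /\ (forall i, i < s -> en i y <> f y).
  apply: unbounded_eventually => //.
  apply: eventually_and; first exact: eventually_fresh.
  apply: eventually_and; first by apply: eventually_comp_inj => //; apply: eventually_fresh.
  by apply: eventually_and => //; apply: eventually_and; apply: eventually_lt.
have [nyl yl] := fy; have [nfl fl] := ffy.
have ql d : In d (points ((u, f y) :: (y, v) :: p)) -> d = y \/ d = f y \/ In d l.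
  by move=> /points_cons [->|[->|/points_cons [->|[->|?]]]]; rewrite /l /=; auto.
have pl d e : edge p d e -> In d l /\ In e l.
  by move=> /points_edge; rewrite /l /=; tauto.
have yisol : isolated en s ((u, f y) :: (y, v) :: p) y.
  split.
    move=> [_ [a [[_ /ne]|[[_ vy]|/pl]]]] //; last tauto.
    by apply: nyl; rewrite /l vy /=; tauto.
  move=> i lt d /ql dq; have [h3 h4] := yl i lt.
  case: dq => [->|[->|dl]]; first tauto.
    by case => [/(h2 _ lt)|/(h1 _ lt)].
  by have := h3 _ dl; tauto.
have fisol : isolated en s ((u, f y) :: (y, v) :: p) (f y).
  split.
    move=> [[a [[uf _]|[[yf _]|/pl ?]]] _]; [|by case: ne|tauto].
    by apply: nfl; rewrite -uf /l /=; tauto.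
  move=> i lt d /ql dq; have [h3 h4] := fl i lt.
  case: dq => [->|[->|dl]]; last by have := h3 _ dl; tauto.
    by case => [/(h1 _ lt)|/(h2 _ lt)].
  tauto.
exists ((u, f y) :: (y, v) :: p); split; [|split].
- apply: valid_cons => //; first apply: valid_cons => //.
  + by move=> z /pl; tauto.
  + move=> z [[yu _]|/nu] //; apply: nyl; rewrite yu /l /=; tauto.
  + move=> z [[_ vf]|/pl]; last tauto.
    by apply: nfl; rewrite -vf /l /=; tauto.
- apply: isolated_good_ext; first by move=> ? ?; right; right.
  by move=> a b [[<- <-]|[[<- <-]|]]; tauto.
- by exists y; split; [left|right; left].
Qed.

Variable i0 j0 : nat.
Hypothesis f_colors : unbounded (fun x => c x = i0 /\ c (f x) = j0).

(** One stage of the construction. The bound [s <= x] makes the points [x] obtained over all stages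
    unbounded. *)
Lemma extend_all s p : valid c m p ->
  exists q, valid c m q /\ good_ext en s p q /\
    (exists v, edge q s v) /\ (exists v, edge q v s) /\
    exists x y, s <= x /\ edge q (f x) (f y) /\ edge q y x.
Proof.
move=> vp.
have [q1 [v1 [g1 [a ea]]]] := extend_domain s p s vp.
have [q2 [v2 [g2 [b eb]]]] := extend_range s q1 s v1.
(* [f x] has no outgoing and [x] no incoming edge yet, and the recurring colour pair [i0], [j0]
   leaves infinitely many candidates for [y]. *)
have [x [[cx cfx] [sx [nx nfx]]]] : exists x, (c x = i0 /\ c (f x) = j0) /\
    s <= x /\ ~ In x (points q2) /\ ~ In (f x) (points q2).
  apply: unbounded_eventually => //; apply: eventually_and; first exact: eventually_ge.
  have ev := eventually_In (fun d y => y <> d) (points q2) eventually_neq.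
  have {}ev : eventually (fun y => ~ In y (points q2)).
    by apply: eventually_mono ev => k h /h.
  apply: eventually_and => //.
  exact: (eventually_comp_inj (fun y => ~ In y (points q2))).
have [||| q3 [v3 [g3 [y [e1 e2]]]]] := extend_hit s q2 (f x) x v2.
- by move=> z /points_edge; tauto.
- by move=> z /points_edge; tauto.
- by rewrite cx cfx.
exists q3; split=> //; split; first by apply: good_ext_trans g3; apply: good_ext_trans g2.
split; first by exists a; apply: (proj1 g3); apply: (proj1 g2).
split; first by exists b; apply: (proj1 g3).
by exists x, y.
Qed.

(** The first pair of edges ends in some [z <> x] instead of [x], so that [g f^-1 g f] moves [x] and
    is not the identity. *)
Lemma initial_valid : (forall x y, x < m -> c x = c y -> x = y) ->
  exists p, valid c m p /\ exists x y, edge p (f x) (f y) /\ exists z, edge p y z /\ z <> x.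
Proof.
move=> c_low.
pose p := map (fun x => (x, x)) (seq 0 m).
have pE x y : edge p x y <-> x = y /\ x < m.
  rewrite /edge /p in_map_iff; split.
    by move=> [z [[<- <-] /in_seq]]; lia.
  by move=> [<- lt]; exists x; split=> //; apply/in_seq; lia.
have vp : valid c m p.
  split.
  - by move=> x y /pE [->].
  - by move=> x y z /pE [<- _] /pE [<- _].
  - by move=> x y z /pE [-> _] /pE [-> _].
  - by move=> x lt; apply/pE.
have [x [[cx cfx] [mx mfx]]] : exists x, (c x = i0 /\ c (f x) = j0) /\ m <= x /\ m <= f x.
  apply: unbounded_eventually => //; apply: eventually_and; first exact: eventually_ge.
  exact: eventually_inj_ge.
have [z [zx cz]] := c_unbounded x mx (S x).
have [||| q [vq [_ [y [e1 e2]]]]] := extend_hit 0 p (f x) z vp.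
- by move=> t /pE; lia.
- by move=> t /pE; lia.
- by rewrite cz cx cfx.
exists q; split=> //; exists x, y; split=> //; exists z; split=> //; lia.
Qed.

Lemma common_stage (P : nat -> nat -> Prop) k :
  (forall t u j, t <= u -> P t j -> P u j) ->
  (forall j, exists t, P t j) -> exists t, forall j, j < k -> P t j.
Proof.
move=> mono h; elim: k => [|k [t IH]]; first by exists 0; lia.
have [u hu] := h k; exists (t + u) => j lt.
case: (Nat.eq_dec j k) => [->|ne]; first by apply: mono hu; lia.
by apply: (mono t); [lia|apply: IH; lia].
Qed.

(** [g] is the union of the stages [P s]. A periodic walk uses finitely many edges, hence lives in
    some stage; the promise of stage [s] then confines it to the finite set of points of [P s]. *)
Lemma generic_permutation : (forall x y, x < m -> c x = c y -> x = y) ->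
  exists g gi : nat -> nat,
    (forall x, gi (g x) = x) /\ (forall x, g (gi x) = x) /\ (forall x, c (g x) = c x) /\
    (forall s, exists l, forall k e i x,
       closed_walk en s (fun a b => g a = b) k e i x -> forall j, In (x j) l) /\
    unbounded (fun x => exists y, g (f x) = f y /\ g y = x) /\
    (exists x y, g (f x) = f y /\ g y <> x).
Proof.
move=> c_low.
have [p0 [vp0 [x0 [y0 [e0 [z0 [e1 zx]]]]]]] := initial_valid c_low.
(* Validity is a premise inside the sigma type, so that the stages are defined by plain recursion
   and proved valid afterwards. *)
have nxt s p : {q | valid c m p -> valid c m q /\ good_ext en s p q /\
    (exists v, edge q s v) /\ (exists v, edge q v s) /\
    exists x y, s <= x /\ edge q (f x) (f y) /\ edge q y x}.
  apply: constructive_indefinite_description.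
  case: (classic (valid c m p)) => [vp|nv]; last by exists p.
  by have [q hq] := extend_all s p vp; exists q.
pose P := nat_rect (fun _ => list (nat * nat)) p0 (fun s p => proj1_sig (nxt s p)).
have vP s : valid c m (P s).
  by elim: s => [|s IH] //=; case: (proj2_sig (nxt s (P s)) IH).
have PS s := proj2 (proj2_sig (nxt s (P s)) (vP s)).
have gP s t : s <= t -> good_ext en s (P s) (P t).
  elim=> [|t' le IH]; first exact: good_ext_refl.
  by apply: good_ext_trans IH _; apply: (good_ext_le _ _ t') => //; case: (PS t').
have iP s t : s <= t -> incl (P s) (P t) by move=> /gP [].
have common s t x y x' y' : edge (P s) x y -> edge (P t) x' y' ->
    edge (P (s + t)) x y /\ edge (P (s + t)) x' y'.
  by move=> h1 h2; split; [apply: (iP s)|apply: (iP t)] => //; lia.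
have ex_g x : {y | exists t, edge (P t) x y}.
  apply: constructive_indefinite_description.
  by have [_ [[v ev] _]] := PS x; exists v, (S x).
have ex_gi x : {y | exists t, edge (P t) y x}.
  apply: constructive_indefinite_description.
  by have [_ [_ [[v ev] _]]] := PS x; exists v, (S x).
pose g x := proj1_sig (ex_g x); pose gi x := proj1_sig (ex_gi x).
have gE t x y : edge (P t) x y -> g x = y.
  move=> e; have [u e'] := proj2_sig (ex_g x).
  have [h1 h2] := common _ _ _ _ _ _ e e'.
  exact: (valid_fun _ _ _ (vP _) _ _ _ h2 h1).
have giE t x y : edge (P t) x y -> gi y = x.
  move=> e; have [u e'] := proj2_sig (ex_gi y).
  have [h1 h2] := common _ _ _ _ _ _ e e'.
  exact: (valid_inj _ _ _ (vP _) _ _ _ h2 h1).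
exists g, gi; split; last split; last split; last split; last split.
- by move=> x; have [t e] := proj2_sig (ex_g x); apply: giE e.
- by move=> x; have [t e] := proj2_sig (ex_gi x); apply: gE e.
- by move=> x; have [t e] := proj2_sig (ex_g x); rewrite (valid_col _ _ _ (vP t) _ _ e).
- move=> s; exists (points (P s)) => k e i x w.
  have [t ht] : exists t, forall j, j < k -> step (edge (P t)) (e j) (en (i j) (x j)) (x (S j)).
    apply: common_stage.
      move=> t u j le; rewrite /step; case: (e j); exact: iP.
    move=> j; have := walk_step _ _ _ _ _ _ _ w j; rewrite /step; case: (e j) => <-.
      exact: (proj2_sig (ex_g _)).
    exact: (proj2_sig (ex_g _)).
  have [h1 h2 h3 h4 h5 h6 _] := w.
  (* The first [k] steps lie in [P t]; the others repeat them. Stage [s + t] is above both [s] and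
     [t]. *)
  have wt : closed_walk en s (edge (P (s + t))) k e i x.
    split=> // j.
    have shift r : step (edge (P (s + t))) (e (r + k)) (en (i (r + k)) (x (r + k))) (x (S (r + k)))
        <-> step (edge (P (s + t))) (e r) (en (i r) (x r)) (x (S r)).
      by rewrite -[S (r + k)]/(S r + k) h2 h3 !h4.
    elim/(well_founded_ind lt_wf): j => j IH.
    case: (le_lt_dec k j) => le.
      have -> : j = j - k + k by lia.
      by apply/shift; apply: IH; lia.
    move: (ht j le); rewrite /step; case: (e j); apply: iP; lia.
  have [_ /(_ _ _ _ _ wt) wsm] := gP s (s + t) ltac:(lia).
  (* [x j] is the end of the step before it, one period later. *)
  move=> j; have := walk_step _ _ _ _ _ _ _ wsm (j + k - 1).
  have -> : S (j + k - 1) = j + k by lia.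
  by rewrite h4 /step; case: (e _) => /points_edge; tauto.
- move=> N; have [_ [_ [_ [x [y [le [e2 e3]]]]]]] := PS N.
  by exists x; split=> //; exists y; split; [apply: (gE (S N))|apply: (gE (S N))].
- exists x0, y0; split; first exact: (gE 0).
  by rewrite (gE 0 _ z0).
Qed.

End Extensions.
(** * Adjoining a permutation to a group *)

Lemma cofinitaryE h : cofinitary h <-> is_identity h \/ eventually_moving h.
Proof.
split=> [[id|[N hN]]|[id|[N hN]]]; [by left| |by left|]; right; exists N => k.
  by move=> le /hN; lia.
by move=> e; apply/Nat.nle_gt => /hN.
Qed.

(** [a] maps the fixed points of [b o a] injectively to those of [a o b]; for bijections the two are
    conjugate. *)
Lemma cofinitary_cyclic a b : injective_nat a ->
  cofinitary (fun k => a (b k)) -> cofinitary (fun k => b (a k)).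
Proof.
move=> ainj /cofinitaryE [id|mv]; apply/cofinitaryE; [left|right].
  by move=> k; apply: ainj; apply: id.
apply: eventually_mono (eventually_comp_inj _ _ ainj mv) => k h e.
by apply: h; rewrite e.
Qed.

Definition power (g gi : nat -> nat) (e : bool) := if e then g else gi.

Fixpoint eval (en : nat -> nat -> nat) g gi (w : list (bool * nat)) (x : nat) :=
  match w with
  | nil => x
  | (e, i) :: w' => eval en g gi w' (power g gi e (en i x))
  end.

(** The group generated by [range en] and [g], as unreduced words: a letter applies a group element
    and then [g] or its inverse, and [b] is what follows the last letter. *)
Definition adjoin en g gi (h : nat -> nat) :=
  exists b w, h = fun k => en b (eval en g gi w k).

Definition letter (w : list (bool * nat)) j := nth (j mod length w) w (true, 0).

Lemma letter_period w j : letter w (j + length w) = letter w j.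
Proof.
rewrite /letter; case: w => [|a w]; first by rewrite Nat.add_0_r.
by rewrite -{1}(Nat.mul_1_l (length _)) Nat.Div0.mod_add.
Qed.

Lemma letter_rotate a w j : letter (w ++ a :: nil) j = letter (a :: w) (S j).
Proof.
rewrite /letter length_app -[length (a :: nil)]/1 -[length (a :: w)]/(S (length w)) Nat.add_1_r.
set L := length w.
have lt := Nat.mod_upper_bound j (S L) ltac:(lia).
have -> : S j mod S L = S (j mod S L) mod S L.
  by rewrite -(Nat.add_1_r j) -Nat.Div0.add_mod_idemp_l Nat.add_1_r.
case: (Nat.eq_dec (j mod S L) L) => [->|ne].
  by rewrite Nat.Div0.mod_same app_nth2 // Nat.sub_diag.
rewrite (Nat.mod_small (S _)); last lia.
by rewrite app_nth1 //; rewrite -/L; lia.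
Qed.

Lemma letter_head a w : letter (a :: w) 0 = a.
Proof. by rewrite /letter Nat.Div0.mod_0_l. Qed.

Lemma letter_second a b w : letter (a :: b :: w) 1 = b.
Proof. by rewrite /letter Nat.mod_small //=; lia. Qed.

Section Adjunction.

Variables (en : nat -> nat -> nat) (g gi : nat -> nat).
Let G h := exists i, en i = h.
Hypothesis G_cofinitary : cofinitary_group G.
Hypothesis giK : forall x, gi (g x) = x.
Hypothesis gK : forall x, g (gi x) = x.
Hypothesis g_walks : forall s, exists l, forall k e i x,
  closed_walk en s (fun a b => g a = b) k e i x -> forall j, In (x j) l.

Let ev := eval en g gi.
Let pw := power g gi.

Let en_bij i : bijective_nat (en i).
Proof. by case: G_cofinitary => [[h _] _]; apply: h; exists i. Qed.

Let en_comp i j : exists k, en k = fun x => en i (en j x).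
Proof. by case: G_cofinitary => [[_ [_ [h _]]] _]; apply: h; [exists i|exists j]. Qed.

Let power_negb e x : pw (negb e) (pw e x) = x.
Proof. by case: e => /=. Qed.

Let eval_inj w : injective_nat (ev w).
Proof.
elim: w => [|[e i] w IH] //= x y /IH h.
apply: (proj1 (en_bij i)).
by rewrite -(power_negb e (en i x)) /pw h -/pw power_negb.
Qed.

Let eval_app w1 w2 x : ev (w1 ++ w2) x = ev w2 (ev w1 x).
Proof. by elim: w1 x => [|[e i] w IH] //= x; apply: IH. Qed.

Let reduced w := forall j, fst (letter w j) <> fst (letter w (S j)) ->
  ~ is_identity (en (snd (letter w (S j)))).

(** Reading [w] cyclically from a fixed point [x] of [ev w] traces a closed walk through [x], so [x]
    belongs to the finite list of [g_walks]. *)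
Let reduced_moving w : w <> nil -> reduced w -> eventually_moving (ev w).
Proof.
move=> wn red.
have wl : 0 < length w by case: w wn {red} => //= *; lia.
pose e j := fst (letter w j); pose i j := snd (letter w j).
have [s hs] : exists s, forall a, In a w -> snd a < s.
  elim: w {wn red wl e i} => [|a w [s IH]]; first by exists 0.
  by exists (S (snd a) + s) => b [<-|/IH]; lia.
have [l hl] := g_walks s.
have nl : eventually (fun x => ~ In x l).
  have := eventually_In (fun d y => y <> d) l eventually_neq.
  by apply: eventually_mono => k h /h.
apply: eventually_mono nl => x nx fx; apply: nx.
pose pos := nat_rect (fun _ => nat) x (fun j y => pw (e j) (en (i j) y)).
have posS j : pos (S j) = pw (e j) (en (i j) (pos j)) by [].
have posE v j : (forall r, r < length v -> letter w (j + r) = nth r v (true, 0)) ->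
    pos (j + length v) = ev v (pos j).
  elim: v j => [|[e' i'] v IH] j hv /=; first by rewrite Nat.add_0_r.
  have h0 := hv 0 ltac:(simpl; lia); rewrite Nat.add_0_r /= in h0.
  rewrite Nat.add_succ_r -Nat.add_succ_l IH; first by rewrite posS /e /i h0.
  move=> r lt; rewrite Nat.add_succ_l -Nat.add_succ_r.
  by rewrite (hv (S r)) //=; lia.
have pos_period j : pos (j + length w) = pos j.
  elim: j => [|j IH]; last by rewrite Nat.add_succ_l !posS IH /e /i letter_period.
  rewrite (posE w 0) // => r lt.
  by rewrite /letter Nat.mod_small.
apply: (hl (length w) e i pos _ 0); split=> //.
- by move=> j; rewrite /e letter_period.
- by move=> j; rewrite /i letter_period.
- move=> j; apply: hs; apply: nth_In; apply: Nat.mod_upper_bound; lia.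
- by move=> j; rewrite /step posS /pw; case: (e j) => /=.
Qed.

(** Rotating a word conjugates its value. This brings any cancelling pair of letters to the front,
    even one that straddles the end of the word. *)
Let rotate j w : w <> nil -> exists w', length w' = length w /\
  (cofinitary (ev w') -> cofinitary (ev w)) /\
  forall i, letter w' i = letter w (i + j).
Proof.
move=> wn; elim: j => [|j [w' [len [cof let']]]].
  by exists w; do !split=> //; move=> i; rewrite Nat.add_0_r.
case: w' len cof let' => [|a w'] len cof let'; first by case: w wn len {cof let'}.
exists (w' ++ a :: nil); split; first by rewrite length_app -len /=; lia.
split; last by move=> i; rewrite letter_rotate let'; f_equal; lia.
move=> h; apply: cof.
have -> : ev (a :: w') = fun k => ev w' (ev (a :: nil) k).
  by apply: functional_extensionality => k; rewrite -eval_app.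
apply: cofinitary_cyclic; first exact: eval_inj.
by apply: (eq_ind _ cofinitary h); apply: functional_extensionality => k; rewrite eval_app.
Qed.

(** Induction on the length. Conjugation merges [b] into the first letter. A cyclically reduced word
    is handled by [reduced_moving]; otherwise a pair [g^e], [g^-e] around a trivial letter is
    rotated to the front and cancelled. *)
Lemma adjoin_cofinitary w b : cofinitary (fun k => en b (eval en g gi w k)).
Proof.
have [n le] : exists n, length w <= n by exists (length w).
elim: n w le b => [|n IH] [|[e i] w] /= le b; try lia;
  try by apply: (proj2 G_cofinitary); exists b.
apply: (cofinitary_cyclic (eval en g gi ((e, i) :: w)) (en b)); first exact: eval_inj.
have [i' i'E] := en_comp i b.
have -> : (fun k => eval en g gi ((e, i) :: w) (en b k)) = ev ((e, i') :: w).
  by apply: functional_extensionality => k; rewrite /ev /= i'E.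
case: (classic (reduced ((e, i') :: w))) => [red|nred].
  by apply/cofinitaryE; right; apply: reduced_moving.
have [j [ne id]] : exists j,
    fst (letter ((e, i') :: w) j) <> fst (letter ((e, i') :: w) (S j)) /\
    is_identity (en (snd (letter ((e, i') :: w) (S j)))).
  apply: NNPP => nj; apply: nred => j ne id; apply: nj; by exists j.
have [w' [len [cof let']]] := rotate j ((e, i') :: w) ltac:(done).
apply: cof.
have l0 : letter ((e, i') :: w) j = letter w' 0 by rewrite let'.
have l1 : letter ((e, i') :: w) (S j) = letter w' 1 by rewrite let'.
move: len ne id {let' nred}; rewrite l0 l1 {l0 l1}.
(* In a one-letter word the letters 0 and 1 coincide, against [ne]. *)
case: w' => [|[e1 i1] [|[e2 i2] r]] len; rewrite ?letter_head ?letter_second //= => ne id.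
simpl in len.
have -> : ev ((e1, i1) :: (e2, i2) :: r) = fun k => ev r (en i1 k).
  apply: functional_extensionality => k; rewrite /ev /= id.
  have -> : e2 = negb e1 by case: (e1) ne; case: (e2).
  by rewrite -/pw power_negb.
apply: (cofinitary_cyclic (en i1) (ev r)); first exact: (proj1 (en_bij i1)).
by apply: IH; lia.
Qed.

Let adjoin_en b : adjoin en g gi (en b).
Proof. by exists b, nil. Qed.

Let adjoin_comp f h : adjoin en g gi f -> adjoin en g gi h -> adjoin en g gi (fun k => f (h k)).
Proof.
move=> [b [w ->]] [b' [w' ->]]; case: w => [|[e i] w].
  have [d dE] := en_comp b b'.
  by exists d, w'; rewrite dE.
have [d dE] := en_comp i b'.
exists b, (w' ++ (e, d) :: w); apply: functional_extensionality => k.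
by rewrite -/ev eval_app /ev /= dE.
Qed.

Let adjoin_power e : adjoin en g gi (power g gi e).
Proof.
have [[_ [[i0 id] _]] _] := G_cofinitary.
by exists i0, ((e, i0) :: nil); apply: functional_extensionality => k; rewrite /= id.
Qed.

Lemma adjoin_contains h : G h -> adjoin en g gi h.
Proof. by move=> [i <-]. Qed.

Lemma adjoin_generator : adjoin en g gi g.
Proof. exact: (adjoin_power true). Qed.

Lemma adjoin_cofinitary_group : cofinitary_group (adjoin en g gi).
Proof.
have [[_ [Gid [_ Ginv]]] _] := G_cofinitary.
have inv f : adjoin en g gi f -> exists h, adjoin en g gi h /\
    (forall k, h (f k) = k) /\ (forall k, f (h k) = k).
  move=> [b [w ->]]; elim: w b => [|[e i] w IH] b /=.
    have [|h [Gh hK]] := Ginv (en b); first by exists b.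
    by exists h; split=> //; apply: adjoin_contains.
  have [h1 [H1 [h1K Kh1]]] := IH b.
  have [|h2 [Gh2 [h2K Kh2]]] := Ginv (en i); first by exists i.
  exists (fun k => h2 (power g gi (negb e) (h1 k))); split.
    apply: adjoin_comp; first exact: adjoin_contains.
    exact: (adjoin_comp (power g gi (negb e))).
  split=> k; first by rewrite h1K -/pw power_negb h2K.
  by rewrite Kh2 -/pw -{1}(Bool.negb_involutive e) power_negb Kh1.
split; last by move=> f [b [w ->]]; apply: adjoin_cofinitary.
split; last by split; [apply: adjoin_contains|].
move=> f /inv [h [_ [hK Kh]]]; split; last by move=> y; exists (h y).
by move=> x y e; rewrite -(hK x) e.
Qed.

Lemma adjoin_colors (c : nat -> nat) :
  (forall h, G h -> forall x, c (h x) = c x) -> (forall x, c (g x) = c x) ->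
  forall h, adjoin en g gi h -> forall x, c (h x) = c x.
Proof.
move=> cG cg h [b [w ->]] x; rewrite cG; last by exists b.
elim: w x => [|[e i] w IH] //= x; rewrite IH.
have -> : c (power g gi e (en i x)) = c (en i x).
  by case: e => /=; [|rewrite -[in RHS](gK (en i x)) cg].
by rewrite cG //; exists i.
Qed.

End Adjunction.

(** * Countability of the enlarged group *)

Definition countable_family (U : (nat -> nat) -> Prop) :=
  exists en : nat -> nat -> nat, forall h, U h <-> exists i, en i = h.

Lemma left_inverse {T : Type} (t0 : T) (code : T -> nat) :
  (forall x y, code x = code y -> x = y) -> exists dec, forall x, dec (code x) = x.
Proof.
move=> inj; exists (fun k => epsilon (inhabits t0) (fun x => code x = k)) => x.
by apply: inj; apply: epsilon_spec (ex_intro (fun y => code y = code x) x eq_refl).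
Qed.

Fixpoint code_word (w : list (bool * nat)) : nat :=
  match w with
  | nil => 0
  | (e, i) :: w' => S (to_nat (if e then 0 else 1, to_nat (i, code_word w')))
  end.

Lemma to_nat_inj a b a' b' : to_nat (a, b) = to_nat (a', b') -> a = a' /\ b = b'.
Proof.
move=> e; have : (a, b) = (a', b') by rewrite -(cancel_of_to (a, b)) e cancel_of_to.
by move=> [-> ->].
Qed.

Lemma code_word_inj w v : code_word w = code_word v -> w = v.
Proof.
elim: w v => [|[e i] w IH] [|[e' i'] v] // h.
have [ee /to_nat_inj [-> /IH ->]] := to_nat_inj _ _ _ _ (eq_add_S _ _ h).
by case: (e) (e') ee => [] [].
Qed.

Lemma adjoin_countable en g gi : countable_family (adjoin en g gi).
Proof.
have [|dec decK] := left_inverse (0, nil)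
  (fun bw : nat * list (bool * nat) => to_nat (fst bw, code_word (snd bw))).
  move=> [b w] [b' w'] h.
  by have [/= -> /code_word_inj /= ->] := to_nat_inj _ _ _ _ h.
exists (fun i k => en (fst (dec i)) (eval en g gi (snd (dec i)) k)) => h; split.
  by move=> [b [w ->]]; exists (to_nat (b, code_word w)); rewrite (decK (b, w)).
by move=> [i <-]; exists (fst (dec i)), (snd (dec i)).
Qed.
(** * The transfinite recursion *)

Definition color_group (c : nat -> nat) (G : (nat -> nat) -> Prop) :=
  cofinitary_group G /\ forall h, G h -> forall x, c (h x) = c x.

Definition included (U V : (nat -> nat) -> Prop) := forall h, U h -> V h.

Definition excluded_above (V : (nat -> nat) -> Prop) (f : nat -> nat) :=
  forall W, cofinitary_group W -> included V W -> ~ W f.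

Definition range (en : nat -> nat -> nat) (h : nat -> nat) := exists i, en i = h.

(** Pigeonhole on the pair of colours, coded in base [K] by a number below [K * K]. *)
Lemma unbounded_color_pair (c : nat -> nat) K (f : nat -> nat) :
  (forall x, c x < K) -> exists i j, unbounded (fun x => c x = i /\ c (f x) = j).
Proof.
move=> cK.
have [|k hk] := unbounded_fiber (fun x => K * c x + c (f x)) (K * K).
  by move=> x; have := cK x; have := cK (f x); nia.
have [x0 [_ e0]] := hk 0.
exists (c x0), (c (f x0)) => N; have [x [le e]] := hk N; exists x; split=> //.
apply: (Nat.div_mod_unique K) => //; lia.
Qed.

(** In a cofinitary group containing [f] and [U], the element [h f] would have to be the identity,
    which makes [f] the inverse of [h], an element of [U]. *)
Lemma excluded_of_coset U f h : cofinitary_group U -> U h -> ~ U f ->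
  ~ eventually_moving (fun y => h (f y)) -> excluded_above U f.
Proof.
move=> [[_ [_ [_ Uinv]]] _] Uh nUf nmv W [[_ [_ [Wcomp _]]] Wcof] sub Wf.
have /cofinitaryE [id|//] := Wcof _ (Wcomp _ _ (sub _ Uh) Wf).
have [h' [Uh' [hK _]]] := Uinv _ Uh.
apply: nUf; have -> // : f = h'.
by apply: functional_extensionality => k; rewrite -{2}(id k) hK.
Qed.

(* [g] makes [g o f^-1 o g o f] a non-identity with infinitely many fixed points. *)
Lemma excluded_of_word V f g :
  V g -> unbounded (fun x => exists y, g (f x) = f y /\ g y = x) ->
  (exists x y, g (f x) = f y /\ g y <> x) -> excluded_above V f.
Proof.
move=> Vg unb [x [y [gf gy]]] W [[_ [_ [Wcomp Winv]]] Wcof] sub Wf.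
have [f' [Wf' [fK _]]] := Winv _ Wf.
have Wg := sub _ Vg.
have /Wcof /cofinitaryE [id|mv] := Wcomp _ _ (Wcomp _ _ Wg Wf') (Wcomp _ _ Wg Wf).
  by apply: gy; rewrite -[RHS](id x) gf fK.
have [z [[t [zf tz]] nz]] := unbounded_eventually _ _ unb mv.
by apply: nz; rewrite zf fK.
Qed.

Section Colors.

Variables (c : nat -> nat) (m K : nat).
Hypothesis c_unbounded : forall x, m <= x -> unbounded (fun y => c y = c x).
Hypothesis c_low : forall x y, x < m -> c x = c y -> x = y.
Hypothesis c_bounded : forall x, c x < K.

(** [U] itself serves unless [f] is a bijection outside [U] and every [h f] with [h] in [U] has
    finitely many fixed points; in that case these finiteness conditions are what the generic [g]
    requires. *)
Lemma decide_membership U f : countable_family U -> color_group c U ->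
  exists V, countable_family V /\ color_group c V /\ included U V /\
    (V f \/ excluded_above V f).
Proof.
move=> Ucount Ugood; have [Ucof Ucol] := Ugood.
have trivial_case : U f \/ excluded_above U f -> exists V,
    countable_family V /\ color_group c V /\ included U V /\ (V f \/ excluded_above V f).
  by move=> h; exists U; do 3!split=> //; move=> ?.
case: (classic (U f)) => [Uf|nUf]; first by apply: trivial_case; left.
case: (classic (bijective_nat f)) => [[finj _]|nbij]; last first.
  by apply: trivial_case; right=> W [[Wbij _] _] _ /Wbij.
case: (classic (exists h, U h /\ ~ eventually_moving (fun y => h (f y)))) => [[h [Uh nmv]]|nh].
  by apply: trivial_case; right; apply: (excluded_of_coset U f h).
have coset h : U h -> eventually_moving (fun y => h (f y)).
  by move=> Uh; apply: NNPP => nmv; apply: nh; exists h.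
have [en enU] := Ucount.
have UE : U = range en.
  by apply: functional_extensionality => h; apply: propositional_extensionality.
have [[Ubij [Uid [_ Uinv]]] Ucofin] := Ucof.
have Uen i : U (en i) by apply/enU; exists i.
have [i0 [j0 unb]] := unbounded_color_pair c K f c_bounded.
have [|||||g [gi [giK [gK [cg [walks [inf ne]]]]]]] :=
  generic_permutation en c m _ _ c_unbounded f finj _ _ _ i0 j0 unb c_low.
- by move=> i; case: (Ubij _ (Uen i)).
- by move=> i; apply/cofinitaryE; apply: Ucofin.
- exact: (coset _ Uid).
- by move=> i; apply: coset.
(* A point where [en i] and [f] agree is a fixed point of [(en i)^-1 f]. *)
- move=> i; have [h [Uh [hK _]]] := Uinv _ (Uen i).
  by apply: eventually_mono (coset _ Uh) => k nk e; apply: nk; rewrite -e hK.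
rewrite UE in Ucof.
exists (adjoin en g gi); split; first exact: adjoin_countable.
split; [split|split].
- exact: adjoin_cofinitary_group.
- by apply: adjoin_colors => //; rewrite UE in Ucol.
- by move=> h; rewrite UE; apply: adjoin_contains.
- by right; apply: excluded_of_word inf ne; apply: adjoin_generator.
Qed.

Lemma chain_union_color_group (Fam : ((nat -> nat) -> Prop) -> Prop) :
  (exists A, Fam A) -> (forall A, Fam A -> color_group c A) ->
  (forall A B, Fam A -> Fam B -> included A B \/ included B A) ->
  color_group c (fun h => exists A, Fam A /\ A h).
Proof.
move=> [A0 F0] good chain; split; last by move=> h [A [/good [_ col] Ah]]; apply: col.
split; last by move=> h [A [/good [[_ cof] _] Ah]]; apply: cof.
split; first by move=> h [A [/good [[[bij _] _] _] Ah]]; apply: bij.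
split; first by exists A0; split=> //; case: (good _ F0) => [[[_ []]]].
split.
  have comp A f h : Fam A -> A f -> A h -> exists B, Fam B /\ B (fun k => f (h k)).
    by move=> FA Af Ah; exists A; split=> //; case: (good _ FA) => [[[_ [_ [co _]]] _] _];
      apply: co.
  move=> f h [A [FA Af]] [B [FB Bh]].
  by case: (chain A B FA FB) => sub; [apply: (comp B)|apply: (comp A)] => //; apply: sub.
move=> f [A [FA Af]]; case: (good _ FA) => [[[_ [_ [_ inv]]] _] _].
by have [h [Ah hK]] := inv _ Af; exists h; split=> //; exists A.
Qed.

Lemma countable_union {X : Type} (A : X -> Prop) (r : X -> nat) (E : X -> nat -> nat -> nat) en0 :
  (forall x y, A x -> A y -> r x = r y -> x = y) ->
  countable_family (fun h => range en0 h \/ exists y, A y /\ range (E y) h).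
Proof.
move=> rinj.
(* Block 0 lists [en0], block [S b] the family whose index has rank [b]; blocks without an index
   repeat [en0]. *)
pose pick a := excluded_middle_informative (exists y, A y /\ r y = a).
exists (fun k => let (a, i) := of_nat k in
  match a with
  | 0 => en0 i
  | S b => match pick b with
           | left ex => E (proj1_sig (constructive_indefinite_description _ ex)) i
           | right _ => en0 i
           end
  end) => h; split.
- move=> [[i <-]|[y [Ay [i <-]]]].
    by exists (to_nat (0, i)); rewrite cancel_of_to.
  exists (to_nat (S (r y), i)); rewrite cancel_of_to.
  case: (pick (r y)) => [ex|[]]; last by exists y.
  case: (constructive_indefinite_description _ ex) => z [Az rz] /=.
  by rewrite (rinj z y).
- move=> [k <-]; case: (of_nat k) => [[|b] i]; first by left; exists i.
  case: (pick b) => [ex|_]; last by left; exists i.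
  case: (constructive_indefinite_description _ ex) => z [Az rz] /=.
  by right; exists z; split=> //; exists i.
Qed.

(** Each function [F x] is decided at stage [x] over the union of the earlier stages, which is
    countable because the segment below [x] is. The union of all stages is maximal, as every
    function is some [F x]. *)
Lemma maximal_extension G0 : CH -> countable_family G0 -> color_group c G0 ->
  exists G, maximal_cofinitary_group G /\ color_group c G /\ included G0 G.
Proof.
move=> ch [en0 en0E] good0.
have [X [R [e [Rwf [Rtot [Rseg esurj]]]]]] := CH_well_order ch.
(* The real [e x] is read as a relation on [nat], and [F x] picks values from it; the graph of [f]
   yields [f]. *)
pose F x i := epsilon (inhabits 0) (fun j => e x (to_nat (i, j)) = true).
have Fsurj f : exists x, F x = f.
  have [x ex] := esurj (fun k => let (i, j) := of_nat k in Nat.eqb j (f i)).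
  exists x; apply: functional_extensionality => i.
  have h : (exists j, e x (to_nat (i, j)) = true) -> e x (to_nat (i, F x i)) = true.
    exact: (epsilon_spec (inhabits 0) (fun j => e x (to_nat (i, j)) = true)).
  apply/Nat.eqb_eq; move: h; rewrite ex !cancel_of_to; apply.
  by exists (f i); rewrite cancel_of_to Nat.eqb_refl.
pose good_step U f en := color_group c (range en) /\ included U (range en) /\
  (range en f \/ excluded_above (range en) f).
(* The recursion chooses enumerations rather than groups, so every stage is countable by
   construction; [Egood] shows by induction that the choice succeeds. *)
pose body x (rec : forall y, R y x -> nat -> nat -> nat) :=
  epsilon (inhabits en0) (good_step
    (fun h => range en0 h \/ exists y (Ryx : R y x), range (rec y Ryx) h) (F x)).
pose E := Fix Rwf (fun _ => nat -> nat -> nat) body.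
pose U x h := range en0 h \/ exists y, R y x /\ range (E y) h.
have EE x : E x = epsilon (inhabits en0) (good_step (U x) (F x)).
  rewrite /E Fix_eq /body.
    congr (epsilon _ (good_step _ _)); apply: functional_extensionality => h.
    apply: propositional_extensionality; rewrite /U.
    by split=> [[|[y [Ry ?]]]|[|[y [Ry ?]]]]; [left|right; exists y|left|right; exists y, Ry].
  move=> y f g fg; have -> // : f = g.
  by do 2!(apply: functional_extensionality_dep => ?).
have range0 : G0 = range en0.
  by apply: functional_extensionality => h; apply: propositional_extensionality.
have Egood x : good_step (U x) (F x) (E x).
  elim/(well_founded_ind Rwf): x => x IH.
  have [r rinj] := Rseg x.
  have Ucount : countable_family (U x) by apply: (countable_union (fun y => R y x) r E).
  have Ucol : color_group c (U x).
    pose Fam A := A = range en0 \/ exists y, R y x /\ A = range (E y).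
    have -> : U x = fun h => exists A, Fam A /\ A h.
      apply: functional_extensionality => h; apply: propositional_extensionality; split.
        move=> [h0|[y [Ry hy]]].
          by exists (range en0); split=> //; left.
        by exists (range (E y)); split=> //; right; exists y.
      by move=> [A [[->|[y [Ry ->]]] Ah]]; [left|right; exists y].
    apply: chain_union_color_group.
    - by exists (range en0); left.
    - by move=> A [->|[y [Ry ->]]]; [rewrite -range0|case: (IH y Ry)].
    - have base y : R y x -> included (range en0) (range (E y)).
        by move=> Ry h h0; have [_ [sub _]] := IH y Ry; apply: sub; left.
      have lower y z : R z x -> R y z -> included (range (E y)) (range (E z)).
        by move=> Rz Ryz h hy; have [_ [sub _]] := IH z Rz; apply: sub; right; exists y.
      move=> A B [->|[y [Ry ->]]] [->|[z [Rz ->]]].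
      + by left=> h.
      + by left; apply: base.
      + by right; apply: base.
      + case: (Rtot y z) => [Ryz|[<-|Rzy]]; [left|left|right]; [exact: lower|by []|exact: lower].
  have [V [[en enV] [Vgood [sub dec]]]] := decide_membership (U x) (F x) Ucount Ucol.
  have VE : V = range en.
    by apply: functional_extensionality => h; apply: propositional_extensionality.
  rewrite EE; apply: epsilon_spec; exists en.
  by rewrite /good_step -VE.
pose Fam A := A = range en0 \/ exists y, A = range (E y).
have base y : included (range en0) (range (E y)).
  by move=> h h0; have [_ [sub _]] := Egood y; apply: sub; left.
have lower y z : R y z -> included (range (E y)) (range (E z)).
  by move=> Ryz h hy; have [_ [sub _]] := Egood z; apply: sub; right; exists y.
exists (fun h => exists A, Fam A /\ A h).
have Ggood : color_group c (fun h => exists A, Fam A /\ A h).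
  apply: chain_union_color_group.
  - by exists (range en0); left.
  - by move=> A [->|[y ->]]; [rewrite -range0|case: (Egood y)].
  - move=> A B [->|[y ->]] [->|[z ->]].
    + by left=> h.
    + by left; apply: base.
    + by right; apply: base.
    + case: (Rtot y z) => [Ryz|[<-|Rzy]]; [left|left|right]; [exact: lower|by []|exact: lower].
split; [split; first by case: Ggood|split=> //].
  (* Stage [x] with [F x = f] either contains [f] or excludes it from every cofinitary group above,
     such as [H]. *)
  move=> H Hcof sub f Hf; have [x Fx] := Fsurj f.
  have [_ [_]] := Egood x; rewrite Fx => -[Ef|ex].
    by exists (range (E x)); split=> //; right; exists x.
  case: (ex H Hcof _ Hf) => h hE.
  by apply: sub; exists (range (E x)); split=> //; right; exists x.
by move=> h h0; exists (range en0); split; [left|rewrite -range0].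
Qed.

End Colors.
(** * An initial group with prescribed orbits *)

Section InitialGroup.

Variables (n m : nat).
Hypothesis n_pos : 0 < n.

Definition color x := if x <? m then x else m + (x - m) mod n.

(** Above [m], the point [m + (r + n * q)] has position [q] in column [r], and [z] acts on all
    positions by bitwise exclusive or. This is a group action, regular on each column, so a
    nontrivial [shift z] fixes only the points below [m]. *)
Definition shift z x :=
  if x <? m then x else m + ((x - m) mod n + n * Nat.lxor ((x - m) / n) z).

Let color_small x : x < m -> color x = x.
Proof. by rewrite /color => /Nat.ltb_lt ->. Qed.

Let color_large r q : r < n -> color (m + (r + n * q)) = m + r.
Proof.
move=> lt; rewrite /color (proj2 (Nat.ltb_ge _ _)); last lia.
have -> : m + (r + n * q) - m = r + q * n by lia.
by rewrite Nat.Div0.mod_add Nat.mod_small.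
Qed.

Let shift_small z x : x < m -> shift z x = x.
Proof. by rewrite /shift => /Nat.ltb_lt ->. Qed.

Let shift_large z r q : r < n ->
  shift z (m + (r + n * q)) = m + (r + n * Nat.lxor q z).
Proof.
move=> lt; rewrite /shift (proj2 (Nat.ltb_ge _ _)); last lia.
have -> : m + (r + n * q) - m = r + q * n by lia.
by rewrite Nat.Div0.mod_add Nat.div_add ?Nat.mod_small ?Nat.div_small //; lia.
Qed.

Let coordinates x : x < m \/ exists r q, r < n /\ x = m + (r + n * q).
Proof.
case: (le_lt_dec m x) => le; [right|by left].
exists ((x - m) mod n), ((x - m) / n); split; first by apply: Nat.mod_upper_bound; lia.
by have := Nat.div_mod_eq (x - m) n; lia.
Qed.

Let shift_0 x : shift 0 x = x.
Proof.
case: (coordinates x) => [/shift_small //|[r [q [lt ->]]]].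
by rewrite shift_large // Nat.lxor_0_r.
Qed.

Let shift_shift y z x : shift z (shift y x) = shift (Nat.lxor y z) x.
Proof.
case: (coordinates x) => [lt|[r [q [lt ->]]]]; first by rewrite !shift_small.
by rewrite !shift_large // Nat.lxor_assoc.
Qed.

Let color_shift z x : color (shift z x) = color x.
Proof.
case: (coordinates x) => [lt|[r [q [lt ->]]]]; first by rewrite !shift_small.
by rewrite shift_large // !color_large.
Qed.

Lemma shift_color_group : color_group color (range shift).
Proof.
have shiftK z x : shift z (shift z x) = x by rewrite shift_shift Nat.lxor_nilpotent.
split; last by move=> h [z <-] x.
split; [split; [|split; [|split]]|].
- move=> h [z <-]; split; last by move=> y; exists (shift z y).
  by move=> x y e; rewrite -(shiftK z x) e.
- by exists 0; apply: functional_extensionality.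
- move=> f h [y <-] [z <-]; exists (Nat.lxor z y).
  by apply: functional_extensionality => k; rewrite shift_shift.
- by move=> f [z <-]; exists (shift z); do !split=> //; exists z.
- move=> f [z <-]; apply/cofinitaryE.
  case: (Nat.eq_dec z 0) => [->|nz]; [by left|right].
  exists m => x le; case: (coordinates x) => [lt|[r [q [lt ->]]]]; first lia.
  rewrite shift_large // => e; apply: nz.
  have qz : Nat.lxor q z = q by nia.
  by rewrite -(Nat.lxor_0_l z) -(Nat.lxor_nilpotent q) Nat.lxor_assoc qz Nat.lxor_nilpotent.
Qed.

Lemma shift_transitive x y : color x = color y -> exists z, shift z x = y.
Proof.
case: (coordinates x) => [xm|[r [q [lt ->]]]]; case: (coordinates y) => [ym|[r' [q' [lt' ->]]]].
- by rewrite !color_small // => ->; exists 0.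
- by rewrite (color_small x) // color_large //; lia.
- by rewrite (color_small y) // color_large //; lia.
- rewrite !color_large // => e; have {e} <- : r = r' by lia.
  exists (Nat.lxor q q'); rewrite shift_large //.
  by rewrite -Nat.lxor_assoc Nat.lxor_nilpotent Nat.lxor_0_l.
Qed.

Lemma color_unbounded x : m <= x -> unbounded (fun y => color y = color x).
Proof.
move=> le N; case: (coordinates x) => [lt|[r [q [lt ->]]]]; first lia.
by exists (m + (r + n * N)); split; [nia|rewrite !color_large].
Qed.

Lemma color_low x y : x < m -> color x = color y -> x = y.
Proof.
move=> lt; rewrite color_small //.
case: (coordinates y) => [ym|[r [q [ltr ->]]]]; first by rewrite color_small.
by rewrite color_large //; lia.
Qed.

Lemma color_bounded x : color x < m + n.
Proof.
case: (coordinates x) => [lt|[r [q [lt ->]]]]; first by rewrite color_small //; lia.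
by rewrite color_large //; lia.
Qed.

Lemma color_ge i : i < n -> color (m + i) = m + i.
Proof. by move=> lt; have := color_large i 0 lt; rewrite Nat.mul_0_r Nat.add_0_r. Qed.

Lemma color_large_color x : m <= x -> exists i, i < n /\ color x = m + i.
Proof.
move=> le; case: (coordinates x) => [lt|[r [q [lt ->]]]]; first lia.
by exists r; rewrite color_large.
Qed.

(** Invariance of colours under [G] and transitivity of the shifts on each colour make the orbits of
    [G] exactly the colour classes. *)
Lemma orbits_of_extension G : color_group color G -> included (range shift) G ->
  num_orbits_with G (infinite_orbit G) n /\ num_orbits_with G (finite_orbit G) m.
Proof.
move=> [_ col] sub.
have orbitE x y : same_orbit G x y <-> color x = color y.
  split=> [[h [Gh <-]]|/shift_transitive [z <-]]; first by rewrite col.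
  by exists (shift z); split=> //; apply: sub; exists z.
have finE x : finite_orbit G x <-> x < m.
  split=> [[N hN]|lt].
    apply/Nat.nle_gt => le; have [y [ley cy]] := color_unbounded x le N.
    by have := hN y; rewrite orbitE cy => /(_ eq_refl); lia.
  by exists m => y /orbitE /(color_low _ _ lt) <-.
split.
- exists (fun i => m + i); split; [|split].
  + by move=> i lt /finE; lia.
  + by move=> i j lti ltj /orbitE; rewrite !color_ge //; lia.
  + move=> x ninf; have le : m <= x by apply/Nat.nlt_ge => /finE.
    have [i [lt ci]] := color_large_color x le.
    by exists i; split=> //; apply/orbitE; rewrite color_ge.
- exists (fun i => i); split; [|split].
  + by move=> i lt; apply/finE.
  + by move=> i j lti ltj /orbitE /(color_low _ _ lti).
  + by move=> x /finE lt; exists x; split=> //; apply/orbitE.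
Qed.

End InitialGroup.

Theorem mainTheorem10 :
  CH ->
  forall n m : nat, 0 < n ->
    exists G : (nat -> nat) -> Prop,
      maximal_cofinitary_group G /\
      num_orbits_with G (infinite_orbit G) n /\
      num_orbits_with G (finite_orbit G) m.
Proof.
move=> ch n m n_pos.
have [|G [Gmax [Gcol sub]]] := maximal_extension (color n m) m (m + n)
  (color_unbounded n m n_pos) (color_low n m n_pos) (color_bounded n m n_pos)
  (range (shift n m)) ch _ (shift_color_group n m n_pos).
  by exists (shift n m).
by exists G; split=> //; apply: orbits_of_extension Gcol sub.
Qed.
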